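(* Every countable domain is algebraic; that is, if $P$ is a domain whose underlying set is countable, then $P$ is an algebraic domain.
   Context: A subset $D$ of a partially ordered set is directed if it is nonempty and every two elements of $D$ have an upper bound in $D$. A dcpo (directed-complete poset) is a partially ordered set $(P,\leq)$ in which every directed subset has a supremum. The way-below relation $\ll$ on a dcpo $P$ is defined by: $x\ll y$ if for every directed subset $D$ of $P$, $y\leq \sup D$ implies $x\leq d$ for some $d\in D$. A domain is a dcpo $P$ such that for every $p\in P$ the set $\{x\in P\mid x\ll p\}$ is directed and has supremum $p$. An element $x$ of a dcpo is compact if $x\ll x$. A domain $P$ is algebraic if for every $p\in P$ the set $\{x\in P\mid x\ll x \text{ and } x\ll p\}$ is directed and has supremum $p$. *)

(* Defs.v *)
From mathcomp Require Import all_boot all_order.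
From mathcomp Require Import boolp classical_sets functions cardinality.

Set Implicit Arguments.
Unset Strict Implicit.
Unset Printing Implicit Defensive.

Import Order.TTheory.

Local Open Scope order_scope.
Local Open Scope classical_set_scope.

Definition directed (d : Order.disp_t) (P : porderType d) (D : set P) : Prop :=
  D !=set0 /\
  forall x y, D x -> D y -> exists2 z, D z & x <= z /\ y <= z.

Definition dcpo (d : Order.disp_t) (P : porderType d) : Prop :=
  forall D : set P, directed D -> exists s : P, isLub D s.

(* "y <= sup D" is expressed through an arbitrary least upper bound of D,
   which is unique, and which exists when P is a dcpo and D is directed. *)
Definition way_below (d : Order.disp_t) (P : porderType d) (x y : P) : Prop :=
  forall (D : set P) (s : P), directed D -> isLub D s -> y <= s ->
    exists2 z, D z & x <= z.

Definition compact_elt (d : Order.disp_t) (P : porderType d) (x : P) : Prop :=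
  way_below x x.

Definition domain (d : Order.disp_t) (P : porderType d) : Prop :=
  dcpo P /\
  forall p : P, directed [set x | way_below x p] /\
                isLub [set x | way_below x p] p.

Definition algebraic_domain (d : Order.disp_t) (P : porderType d) : Prop :=
  domain P /\
  forall p : P,
    directed [set x | compact_elt x /\ way_below x p] /\
    isLub [set x | compact_elt x /\ way_below x p] p.

(* Main.v *)
Require Import Defs.
From mathcomp Require Import all_boot all_order.
From mathcomp Require Import boolp classical_sets functions cardinality.

(** In a domain it is enough to interpolate a compact element between any two
    elements [x] and [y] with [x] way below [y] ([compact_interpolation]): the
    compact elements way below [p] are then cofinal among all the elements way
    below [p], hence form a directed set with the same supremum.

    That a countable domain has these compact elements is a diagonal argument.
    Suppose that the order interval from [x] to [y] contains no compact element.
    Interpolating twice gives [b] and [c] with x << b << c << y.  The intervals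
    from [x] to [b] and from [c] to [y] are disjoint, because a common element
    [p] gives c <= p <= b << c, which makes [c] compact.  So any given point is
    avoided by a subinterval of the same kind ([avoid_point]).  Avoiding the
    points of the domain one after the other produces a decreasing sequence of
    intervals with no common point, which is absurd: the supremum of the lower
    ends lies in all of them. *)

Section CountableDomains.

Set Implicit Arguments.
Unset Strict Implicit.
Import Order.TTheory.
Local Open Scope order_scope.
Local Open Scope classical_set_scope.

Context (d : Order.disp_t) (P : porderType d).
Implicit Types (x y z p a b : P).

Lemma le_way_below x y z : x <= y -> way_below y z -> way_below x z.
Proof.
by move=> xy yz D s dD lD /(yz D s dD lD)[w Dw yw]; exists w => //;
  apply: le_trans yw.
Qed.

Lemma way_below_le x y z : way_below x y -> y <= z -> way_below x z.
Proof. by move=> xy yz D s dD lD zs; apply: (xy D s dD lD); apply: le_trans zs. Qed.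

(** A point is the supremum of the directed set that it forms by itself. *)
Lemma way_belowW x y : way_below x y -> x <= y.
Proof.
move=> /(_ [set y] y); case=> [||//|z /= -> //].
- split; first by exists y.
  by move=> _ _ /= -> ->; exists y.
- by split=> [_ /= -> // | b]; apply.
Qed.

Section Interpolation.

Hypothesis domP : domain P.

(** The elements that are two steps below [p] form a directed set whose
    supremum is still [p]; the definition of way-below, applied to this set,
    provides the intermediate element. *)
Lemma way_below_interpolation x p : way_below x p ->
  exists2 z, way_below x z & way_below z p.
Proof.
move=> xp; have [_ cont] := domP.
have [[[z0 z0p] dirp] [_ lubp]] := cont p.
pose D := [set w | exists2 z, way_below w z & way_below z p].
have dirD : directed D.
  split.
    by have [[[w wz] _] _] := cont z0; exists w, z0.
  move=> w1 w2 [z1 wz1 zp1] [z2 wz2 zp2].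
  have [z zp [z1z z2z]] := dirp _ _ zp1 zp2.
  have [[_ dirz] _] := cont z.
  have [w wz w12] := dirz w1 w2 (way_below_le wz1 z1z) (way_below_le wz2 z2z).
  by exists w => //; exists z.
have lubD : isLub D p.
  split=> [w [z wz zp] | u ubu].
    exact: le_trans (way_belowW wz) (way_belowW zp).
  apply: lubp => z zp; have [_ [_ lubz]] := cont z.
  by apply: lubz => w wz; apply: ubu; exists z.
have [w [z wz zp] xw] := xp D p dirD lubD (lexx p).
by exists z => //; apply: le_way_below xw wz.
Qed.

(** The intervals through which the diagonal argument descends. Their ends are
    related by way-below, so that there is room to interpolate again. *)
Definition compact_free (I : P * P) : Prop :=
  way_below I.1 I.2 /\ forall k, compact_elt k -> I.1 <= k -> k <= I.2 -> False.

Lemma avoid_point (I : P * P) p : compact_free I ->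
  exists J : P * P, [/\ compact_free J, I.1 <= J.1, J.2 <= I.2
                      & ~ (J.1 <= p /\ p <= J.2)].
Proof.
case: I => x y [/= xy nocpt].
have [b xb yb] := way_below_interpolation xy.
have [c bc cy] := way_below_interpolation yb.
have xc : x <= c := le_trans (way_belowW xb) (way_belowW bc).
have [[xp pb]|npxb] := pselect (x <= p /\ p <= b).
- exists (c, y); split=> //=.
    by split=> //= k kk ck; apply: nocpt => //; apply: le_trans ck.
  move=> [cp _]; apply: (nocpt c) (way_belowW cy) => //.
  exact: le_way_below (le_trans cp pb) bc.
- exists (x, b); split=> //=; last exact: way_belowW.
  split=> //= k kk xk kb; apply: (nocpt k) => //.
  exact: le_trans kb (way_belowW yb).
Qed.

(** The step of the diagonal argument is indexed by codes because [f] need not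
    be surjective; the interval is kept when no point has code [n]. *)
Lemma avoid_code (f : P -> nat) (I : P * P) n : injective f -> compact_free I ->
  exists J : P * P, [/\ compact_free J, I.1 <= J.1, J.2 <= I.2
                      & forall p, f p = n -> ~ (J.1 <= p /\ p <= J.2)].
Proof.
move=> injf cfI; have [[q fq]|nq] := pselect (exists q, f q = n).
- have [J [cfJ IJ JI nJ]] := avoid_point q cfI.
  by exists J; split=> // p fp; have -> : p = q by apply: injf; rewrite fp fq.
- by exists I; split=> // p fp; case: nq; exists p.
Qed.

(** The supremum of an increasing sequence lies below every upper bound, hence
    in every interval of the sequence: the intersection of the intervals of the
    diagonal argument cannot be empty. *)
Lemma nested_intervals (I : nat -> P * P) :
  (forall n, (I n).1 <= (I n).2) ->
  (forall n, (I n).1 <= (I n.+1).1) -> (forall n, (I n.+1).2 <= (I n).2) ->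
  exists s, forall n, (I n).1 <= s /\ s <= (I n).2.
Proof.
move=> Ile lS rS; have [dcP _] := domP.
have lmono : {homo (fun n => (I n).1) : m n / (m <= n)%N >-> m <= n}.
  by apply: homo_leq => // y x z; apply: le_trans.
have rmono : {homo (fun n => (I n).2) : m n / (m <= n)%N >-> n <= m}.
  by apply: homo_leq => // y x z xy yz; apply: le_trans yz xy.
have [] := dcP [set (I n).1 | n in [set: nat]].
  split; first by exists (I 0).1, 0.
  move=> _ _ [m _ <-] [n _ <-]; exists (I (maxn m n)).1; first by exists (maxn m n).
  by split; apply: lmono; rewrite ?leq_maxl ?leq_maxr.
move=> s [ubs lubs]; exists s => n; split; first by apply: ubs; exists n.
apply: lubs => _ [m _ <-].
apply: le_trans (lmono _ _ (leq_maxl m n)) _.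
exact: le_trans (Ile _) (rmono _ _ (leq_maxr m n)).
Qed.

Hypothesis countP : countable [set: P].

Lemma compact_interpolation x y : way_below x y ->
  exists k, [/\ compact_elt k, x <= k & k <= y].
Proof.
move=> xy; apply: contrapT => nok.
have cf0 : compact_free (x, y).
  by split=> //= k kk xk ky; apply: nok; exists k.
have /countable_injP[f injf] := countP.
have {}injf : injective f by move=> a b; apply: injf; rewrite inE.
have [step stepP] : {step : nat * (P * P) -> P * P & forall nI,
    compact_free nI.2 ->
    [/\ compact_free (step nI), nI.2.1 <= (step nI).1, (step nI).2 <= nI.2.2
      & forall p, f p = nI.1 -> ~ ((step nI).1 <= p /\ p <= (step nI).2)]}.
  apply: (@choice _ _ (fun nI J => compact_free nI.2 ->
    [/\ compact_free J, nI.2.1 <= J.1, J.2 <= nI.2.2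
      & forall p, f p = nI.1 -> ~ (J.1 <= p /\ p <= J.2)])) => -[n I].
  have [cfI|ncfI] := pselect (compact_free I); last by exists I.
  by have [J HJ] := avoid_code n injf cfI; exists J.
pose I := fix I n := if n is m.+1 then step (m, I m) else (x, y).
have cfI n : compact_free (I n).
  by elim: n => [//|n IH]; have [] := stepP (n, I n) IH.
have stepI n := stepP (n, I n) (cfI n).
have [|||s sI] := @nested_intervals I.
- by move=> n; have [/way_belowW] := cfI n.
- by move=> n; have [] := stepI n.
- by move=> n; have [] := stepI n.
(* The point s has been excluded when its own code was reached. *)
by have [_ _ _ /(_ s erefl)] := stepI (f s); apply; apply: (sI (f s).+1).
Qed.

Lemma compact_cofinal x p : way_below x p ->
  exists k, [/\ compact_elt k, way_below k p & x <= k].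
Proof.
move=> /way_below_interpolation[z xz zp].
have [k [kk xk kz]] := compact_interpolation xz.
by exists k; split=> //; apply: le_way_below kz zp.
Qed.

End Interpolation.

End CountableDomains.

Theorem mainTheorem2 (d : Order.disp_t) (P : porderType d) :
  domain P -> countable [set: P]%classic -> algebraic_domain P.
Proof.
move=> domP countP; split=> // p.
have [_ /(_ p)[[[x0 x0p] dirp] [ubp lubp]]] := domP.
split; split.
- by have [k [kk kp _]] := compact_cofinal domP countP x0p; exists k.
- move=> k1 k2 [_ k1p] [_ k2p].
  have [z zp [k1z k2z]] := dirp _ _ k1p k2p.
  have [k [kk kp zk]] := compact_cofinal domP countP zp.
  by exists k => //; split; [apply: Order.le_trans k1z zk
                            | apply: Order.le_trans k2z zk].
- by move=> k [_]; apply: ubp.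
- move=> u ubu; apply: lubp => x xp.
  have [k [kk kp xk]] := compact_cofinal domP countP xp.
  by apply: Order.le_trans xk _; apply: ubu.
Qed.
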